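(* Let $K=\mathbb C$, $n\ge2$, and let $G=S_n$ act on $S=K[x_1,\dots,x_n]$ by permuting the variables. For a partition $\lambda$ of $n$ with irreducible representation $V_\lambda$, let $M_\lambda=\mathrm{Hom}_{KG}(V_\lambda,S/(J))$ be the module of the $\lambda$-isotypical component of $S/(J)$. Then $$\mathrm{rank}_{R/(\Delta)}(M_\lambda)=\dim(V_\lambda)\left(\frac12+\frac{A-F}{2m}\right),$$ where $F=\sum_kf_k$ is the total footlength and $A=\sum_ka_k$ is the total armlength of the Young diagram of $\lambda$.
   Context: $R=S^G=K[f_1,\dots,f_n]$, the ring of symmetric polynomials with homogeneous basic invariants $f_k$ of degree $k$; $J=\det(\partial f_i/\partial x_j)$, up to scalar $\prod_{i<j}(x_i-x_j)$; $\Delta=J^2\in R$ the discriminant; $m=\binom n2$ the number of reflections (transpositions). Representations are indexed so that $\lambda=(n)$ is the trivial one. For a cell $k$ of the Young diagram of $\lambda$, the footlength (leg length) $f_k$ is the number of cells strictly below it in its column and the armlength $a_k$ is the number of cells strictly to its right in its row (rows having lengths given by the parts of $\lambda$). *)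

(* Defs.v *)
From HB Require Import structures.
From mathcomp Require Import all_boot all_order all_algebra all_fingroup.
From mathcomp Require Import mxrepresentation generic_quotient.
From mathcomp Require Import mpoly complex.
From mathcomp Require Import boolp functions reals.

Set Implicit Arguments.
Unset Strict Implicit.
Unset Printing Implicit Defensive.

Import GRing.Theory.
Local Open Scope ring_scope.
Local Open Scope quotient_scope.

Section PrincipalQuotient.
Variables (A : comNzRingType) (a : A).

Definition principal : pred A := fun x => `[< exists y, x = y * a >].

Lemma principalP x : reflect (exists y, x = y * a) (x \in principal).
Proof. exact: asboolP. Qed.

Lemma principal_zmod_closed : zmod_closed principal.
Proof.
split; first by apply/principalP; exists 0; rewrite mul0r.
move=> x y /principalP[u ->] /principalP[v ->].
by apply/principalP; exists (u - v); rewrite mulrBl.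
Qed.

HB.instance Definition _ :=
  GRing.isZmodClosed.Build A principal principal_zmod_closed.

Lemma principalMl x y : y \in principal -> x * y \in principal.
Proof.
by move=> /principalP[u ->]; apply/principalP; exists (x * u); rewrite mulrA.
Qed.

(* The library's {ideal_quot I} is a ring only for proper ideals; here [a] may
   be a unit, in which case the quotient is the zero ring. *)
Local Notation idl := (GRing.ZmodClosed.clone A principal _).

Definition pquot := Quotient.quot idl.

HB.instance Definition _ := GRing.Zmodule.on pquot.
HB.instance Definition _ : EqQuotient A (Quotient.equiv idl) pquot :=
  EqQuotient.on pquot.

Definition pquot_pi : A -> pquot := \pi_pquot.

Lemma pi_eqP x y : reflect (pquot_pi x = pquot_pi y) (x - y \in principal).
Proof. by rewrite Quotient.idealrBE; apply: eqP. Qed.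

Lemma pi_repr (q : pquot) : pquot_pi (repr q) = q.
Proof. exact: reprK. Qed.

Lemma pi_zmod_morphism : zmod_morphism pquot_pi.
Proof. by move=> x y; rewrite /pquot_pi !piE. Qed.

HB.instance Definition _ := GRing.isZmodMorphism.Build A pquot pquot_pi
  pi_zmod_morphism.

Definition pquot_mul (x y : pquot) : pquot := pquot_pi (repr x * repr y).

Lemma pi_mul x y : pquot_pi (x * y) = pquot_mul (pquot_pi x) (pquot_pi y).
Proof.
apply/pi_eqP; have /pi_eqP xI := esym (pi_repr (pquot_pi x)).
have /pi_eqP yI := esym (pi_repr (pquot_pi y)).
rewrite -[x * y](addrNK (x * repr (pquot_pi y))) -mulrBr -addrA -mulrBl.
apply: (rpredD (S := idl)); first exact: principalMl.
by rewrite mulrC; exact: principalMl.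
Qed.

Lemma pquot_mulA : associative pquot_mul.
Proof.
by move=> x y z; rewrite -[x]pi_repr -[y]pi_repr -[z]pi_repr -!pi_mul mulrA.
Qed.

Lemma pquot_mulC : commutative pquot_mul.
Proof. by move=> x y; rewrite /pquot_mul mulrC. Qed.

Lemma pquot_mul1 : left_id (pquot_pi 1) pquot_mul.
Proof. by move=> x; rewrite -[x]pi_repr -pi_mul mul1r. Qed.

Lemma pquot_mulDl : left_distributive pquot_mul +%R.
Proof.
move=> x y z; rewrite -[x]pi_repr -[y]pi_repr -[z]pi_repr.
by rewrite -raddfD -!pi_mul mulrDl raddfD.
Qed.

HB.instance Definition _ := GRing.Zmodule_isComPzRing.Build pquot
  pquot_mulA pquot_mulC pquot_mul1 pquot_mulDl.

Lemma pi_monoid_morphism : monoid_morphism pquot_pi.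
Proof. by split=> // x y; rewrite pi_mul. Qed.

HB.instance Definition _ := GRing.isMonoidMorphism.Build A pquot pquot_pi
  pi_monoid_morphism.

End PrincipalQuotient.

Section SymmetricPolynomials.
Variables (n : nat) (K : fieldType).

Record sympoly :=
  Sympoly { sympoly_val :> {mpoly K[n]}; _ : sympoly_val \is symmetric }.

HB.instance Definition _ := [isSub for sympoly_val].
HB.instance Definition _ := [Choice of sympoly by <:].
HB.instance Definition _ := [SubChoice_isSubComNzRing of sympoly by <:].

Lemma msym_sympoly s (p : sympoly) : msym s p = p.
Proof. exact/issymP/valP. Qed.

(* The invariant [f i] has degree [i.+1], as ['I_n] starts at 0. *)
Definition basic_invariants (f : 'I_n -> sympoly) : Prop :=
  (forall i, (f i : {mpoly K[n]}) \is i.+1.-homog) /\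
  (forall p : sympoly, exists q : {mpoly K[n]},
     p = q \mPo [tuple (f i : {mpoly K[n]}) | i < n] :> {mpoly K[n]}).

Lemma msym_mderiv s (p : {mpoly K[n]}) i :
  msym s p^`M(i) = (msym s p)^`M(s i).
Proof.
apply/mpolyP => m; rewrite mcoeff_sym !mcoeff_deriv mcoeff_sym mnmE.
congr (p@_ _ *+ _); apply/mnmP => j.
by rewrite !mnmE (inj_eq perm_inj).
Qed.

Variable f : 'I_n -> sympoly.

Definition jacobian : {mpoly K[n]} :=
  \det (\matrix_(i < n, j < n) (f i : {mpoly K[n]})^`M(j)).

Lemma msym_jacobian (s : 'S_n) : msym s jacobian = (-1) ^+ s * jacobian.
Proof.
rewrite /jacobian -det_map_mx -odd_permV -det_perm mulrC -det_mulmx -col_permE.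
congr (\det _); apply/matrixP => i j; rewrite !mxE.
by rewrite /= msym_mderiv msym_sympoly.
Qed.

Lemma discriminant_sym : jacobian ^+ 2 \is symmetric.
Proof.
apply/issymP => s.
by rewrite rmorphXn /= msym_jacobian exprMn sqrr_sign mul1r.
Qed.

Definition discriminant : sympoly := Sympoly discriminant_sym.

(* R/(Delta) and S/(J) *)
Definition RDelta := pquot discriminant.
Definition SJ := pquot jacobian.

HB.instance Definition _ := GRing.ComPzRing.on RDelta.
HB.instance Definition _ := GRing.ComPzRing.on SJ.

Definition SJ_scale (c : K) (x : SJ) : SJ := pquot_pi jacobian c%:MP * x.

Fact SJ_scaleA c d x : SJ_scale c (SJ_scale d x) = SJ_scale (c * d) x.
Proof. by rewrite /SJ_scale mulrA -rmorphM mpolyCM. Qed.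
Fact SJ_scale1 : left_id 1 SJ_scale.
Proof. by move=> x; rewrite /SJ_scale rmorph1 mul1r. Qed.
Fact SJ_scaleDr : right_distributive SJ_scale +%R.
Proof. by move=> c x y; rewrite /SJ_scale mulrDr. Qed.
Fact SJ_scaleDl x : {morph SJ_scale^~ x : c d / c + d}.
Proof. by move=> c d; rewrite /SJ_scale !raddfD /= mulrDl. Qed.

HB.instance Definition _ := GRing.Zmodule_isLmodule.Build K SJ
  SJ_scaleA SJ_scale1 SJ_scaleDr SJ_scaleDl.

Definition SJ_act (s : 'S_n) (x : SJ) : SJ :=
  pquot_pi jacobian (msym s (repr x)).

Lemma SJ_act_pi s p :
  SJ_act s (pquot_pi jacobian p) = pquot_pi jacobian (msym s p).
Proof.
apply/pi_eqP; rewrite -msymB.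
have /pi_eqP/principalP[q ->] := pi_repr (pquot_pi jacobian p).
by rewrite msymM msym_jacobian mulrA principalMl //; apply/principalP;
  exists 1; rewrite mul1r.
Qed.

(* The ring morphism R/(Delta) -> S/(J) induced by the inclusion of R in S *)
Definition RDelta_SJ (r : RDelta) : SJ :=
  pquot_pi jacobian (repr r : sympoly).

Lemma RDelta_SJ_pi (r : sympoly) :
  RDelta_SJ (pquot_pi discriminant r) = pquot_pi jacobian r.
Proof.
apply/pi_eqP; have /pi_eqP/principalP[q] := pi_repr (pquot_pi discriminant r).
move/(congr1 val); rewrite /= => ->.
by rewrite expr2 mulrA; apply/principalP; eexists.
Qed.

Lemma RDelta_SJ_zmod_morphism : zmod_morphism RDelta_SJ.
Proof.
move=> x y; rewrite -[x]pi_repr -[y]pi_repr -raddfB !RDelta_SJ_pi.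
by rewrite -raddfB.
Qed.

Lemma RDelta_SJ_monoid_morphism : monoid_morphism RDelta_SJ.
Proof.
split=> [|x y]; first by rewrite -(rmorph1 (pquot_pi _)) RDelta_SJ_pi rmorph1.
by rewrite -[x]pi_repr -[y]pi_repr -rmorphM !RDelta_SJ_pi -rmorphM.
Qed.

HB.instance Definition _ := GRing.isZmodMorphism.Build RDelta SJ RDelta_SJ
  RDelta_SJ_zmod_morphism.
HB.instance Definition _ := GRing.isMonoidMorphism.Build RDelta SJ RDelta_SJ
  RDelta_SJ_monoid_morphism.

Lemma RDelta_SJ_act s r x :
  SJ_act s (RDelta_SJ r * x) = RDelta_SJ r * SJ_act s x.
Proof.
rewrite -[r]pi_repr -[x]pi_repr RDelta_SJ_pi -rmorphM !SJ_act_pi.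
by rewrite -rmorphM msymM msym_sympoly.
Qed.

Lemma SJ_act_zmod_morphism s : zmod_morphism (SJ_act s).
Proof.
move=> x y; rewrite -[x]pi_repr -[y]pi_repr -raddfB !SJ_act_pi.
by rewrite -raddfB msymB.
Qed.

HB.instance Definition _ s := GRing.isZmodMorphism.Build SJ SJ (SJ_act s)
  (SJ_act_zmod_morphism s).

Section Hom.
Variables (d : nat) (rV : mx_representation K [set: 'S_n] d).

(* Both [rV], acting on row vectors from the right, and [msym] compose in the
   order of the product of permutations: x (s t) = (x s) t. *)
Definition is_homG (phi : 'rV[K]_d -> SJ) : Prop :=
  linear phi /\ forall (s : 'S_n) v, phi (v *m rV s) = SJ_act s (phi v).

Definition homG_pred : pred ('rV[K]_d -> SJ) := fun phi => `[< is_homG phi >].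

Lemma homG_zmod_closed : zmod_closed homG_pred.
Proof.
split.
  apply/asboolP; split=> [c u v|s v]; first by rewrite scaler0 addr0.
  by rewrite raddf0.
move=> phi psi /asboolP[phiL phiG] /asboolP[psiL psiG]; apply/asboolP.
split=> [c u v|s v].
  change (phi (c *: u + v) - psi (c *: u + v) =
    c *: (phi u - psi u) + (phi v - psi v)).
  by rewrite phiL psiL scalerBr opprD addrACA.
change (phi (v *m rV s) - psi (v *m rV s) = SJ_act s (phi v - psi v)).
by rewrite phiG psiG raddfB.
Qed.

HB.instance Definition _ :=
  GRing.isZmodClosed.Build ('rV[K]_d -> SJ) homG_pred homG_zmod_closed.

(* Hom_KG(V, S/(J)) as a module over R/(Delta) *)
Record homG := HomG { homG_val :> 'rV[K]_d -> SJ; _ : homG_val \in homG_pred }.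

HB.instance Definition _ := [isSub for homG_val].
HB.instance Definition _ := [Choice of homG by <:].
HB.instance Definition _ := [SubChoice_isSubZmodule of homG by <:].

Lemma homGP (phi : homG) : is_homG phi.
Proof. exact/asboolP/(valP phi). Qed.

Fact homG_scale_subproof (r : RDelta) (phi : homG) :
  (fun v => RDelta_SJ r * phi v) \in homG_pred.
Proof.
have [phiL phiG] := homGP phi; apply/asboolP; split=> [c u v|s v].
  by rewrite phiL mulrDr mulrCA.
by rewrite phiG RDelta_SJ_act.
Qed.

Definition homG_scale r phi : homG := HomG (homG_scale_subproof r phi).

Fact homG_scaleA r s phi :
  homG_scale r (homG_scale s phi) = homG_scale (r * s) phi.
Proof.
by apply: val_inj; apply: funext => v /=; rewrite mulrA -rmorphM.
Qed.
Fact homG_scale1 : left_id 1 homG_scale.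
Proof.
by move=> phi; apply: val_inj; apply: funext => v /=; rewrite rmorph1 mul1r.
Qed.
Fact homG_scaleDr : right_distributive homG_scale +%R.
Proof.
move=> r phi psi; apply: val_inj; apply: funext => v.
exact: mulrDr.
Qed.
Fact homG_scaleDl phi : {morph homG_scale^~ phi : r s / r + s}.
Proof.
move=> r s; apply: val_inj; apply: funext => v /=.
by rewrite rmorphD mulrDl.
Qed.

HB.instance Definition _ := GRing.Zmodule_isLmodule.Build RDelta homG
  homG_scaleA homG_scale1 homG_scaleDr homG_scaleDl.

End Hom.
End SymmetricPolynomials.

(* Rank of a module over an integral domain: the maximal number of linearly
   independent elements, i.e. the dimension over the fraction field. *)
Section Rank.
Variables (A : pzRingType) (M : lmodType A).

Definition lin_indep r (v : 'I_r -> M) : Prop :=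
  forall a : 'I_r -> A, \sum_(i < r) a i *: v i = 0 -> forall i, a i = 0.

Definition has_rank (r : nat) : Prop :=
  (exists v : 'I_r -> M, lin_indep v) /\
  (forall s (v : 'I_s -> M), lin_indep v -> (s <= r)%N).

End Rank.

Definition is_partition (n : nat) (la : seq nat) : bool :=
  [&& sorted geq la, 0%N \notin la & sumn la == n].

Section YoungDiagram.
Variable la : seq nat.

(* Cells (i, j) in row i and column j, listed row by row *)
Definition cells : seq (nat * nat) :=
  [seq (i, j) | i <- iota 0 (size la), j <- iota 0 (nth 0%N la i)].

Definition armlength (c : nat * nat) : nat :=
  count (fun c' => (c'.1 == c.1) && (c.2 < c'.2)%N) cells.
Definition footlength (c : nat * nat) : nat :=
  count (fun c' => (c'.2 == c.2) && (c.1 < c'.1)%N) cells.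

Definition total_armlength : nat := (\sum_(c <- cells) armlength c)%N.
Definition total_footlength : nat := (\sum_(c <- cells) footlength c)%N.

End YoungDiagram.

Section Specht.
Variables (n : nat) (K : fieldType) (la : seq nat).

Local Notation G := [set: 'S_n]%G.
Local Notation cell k := (nth (0%N, 0%N) (cells la) k).

(* Row and column stabilisers of the tableau with entry k in the k-th cell *)
Definition row_stab : {set 'S_n} :=
  [set s : 'S_n | [forall k : 'I_n, (cell (s k)).1 == (cell k).1]].
Definition col_stab : {set 'S_n} :=
  [set s : 'S_n | [forall k : 'I_n, (cell (s k)).2 == (cell k).2]].

(* The Young symmetrizer, as an element of the regular representation. The
   product [q * p] of permutations is the function i |-> p (q i). *)
Definition young_symmetrizer : 'rV[K]_#|G| :=
  \sum_(p in row_stab) \sum_(q in col_stab)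
    (-1) ^+ q *: delta_mx 0 (gring_index G (q * p)%g).

(* The irreducible representation V_la: the submodule of the regular
   representation generated by the Young symmetrizer *)
Definition specht_mx : 'M[K]_#|G| :=
  cyclic_mx (regular_repr K G) young_symmetrizer.

Definition dim_specht : nat := \rank specht_mx.

Definition specht : mx_representation K G dim_specht :=
  submod_repr (cyclic_mx_module (regular_repr K G) young_symmetrizer).

End Specht.

(* Main.v *)
From HB Require Import structures.
Require Import Defs.
From mathcomp Require Import all_boot all_order all_algebra all_fingroup.
From mathcomp Require Import mxrepresentation generic_quotient fraction.
From mathcomp Require Import mpoly complex boolp reals zify ring.

(* Write s for a transposition (a b). Modulo J, a G-homomorphism V -> S/(J) is
   determined by its restriction to the hyperplane x_a = x_b, where s acts
   trivially; hence the rank over R/(Delta) is the dimension of the s-invariants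
   of V, which is the rank of 1 + s, namely (dim V + chi(s)) / 2. Independent
   homomorphisms, and invariant coefficients for linear relations, come from
   summing over the group after multiplying by a polynomial u that vanishes at
   every permutation of a generic point z of the hyperplane, except at z itself.
   Finally the sum of all transpositions is central and multiplies the Young
   symmetrizer by A - F: a transposition inside a row (column) contributes 1
   (-1), and any other one contributes 0. Taking traces,
   m chi(s) = (A - F) dim V. *)

Set Implicit Arguments.
Unset Strict Implicit.
Unset Printing Implicit Defensive.

Import Order.TTheory GRing.Theory Num.Theory.
Local Open Scope ring_scope.

(** * Linear substitutions and divisibility by linear forms *)

Section Substitution.
Variables (n : nat) (K : idomainType).
Implicit Types (p q g : {mpoly K[n]}) (i j : 'I_n).

(** Serves to compare ring morphisms and derivations on constants and variables only. *)
Lemma mpoly_ring_ind (P : {mpoly K[n]} -> Prop) :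
    (forall c, P c%:MP) -> (forall i, P 'X_i) ->
    (forall p q, P p -> P q -> P (p + q)) ->
    (forall p q, P p -> P q -> P (p * q)) ->
  forall p, P p.
Proof.
move=> PC PX PD PM; elim/mpolyind => [|c m p _ _ Pp].
  by rewrite -(mpolyC0 n); apply: (PC).
apply: (PD) => //; rewrite -mul_mpolyC; apply: (PM) => //.
rewrite mpolyXE_id; apply: big_ind => [||i _]; first by rewrite -mpolyC1.
  exact: (PM).
by elim: (m i) => [|k IHk]; rewrite ?expr0 -?mpolyC1 // exprS; apply: (PM).
Qed.

(** With [g = 'X_i] this is restriction to the hyperplane x_i = x_j, kept inside the same polynomial
    ring. *)
Definition subst j g p := p \mPo [tuple if i == j then g else 'X_i | i < n].

Fact subst_zmod_morphism j g : zmod_morphism (subst j g).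
Proof. exact: comp_mpolyB. Qed.

Fact subst_monoid_morphism j g : monoid_morphism (subst j g).
Proof. by split=> [|p q]; rewrite /subst ?rmorph1 ?rmorphM. Qed.

HB.instance Definition _ j g := GRing.isZmodMorphism.Build {mpoly K[n]}
  {mpoly K[n]} (subst j g) (subst_zmod_morphism j g).
HB.instance Definition _ j g := GRing.isMonoidMorphism.Build {mpoly K[n]}
  {mpoly K[n]} (subst j g) (subst_monoid_morphism j g).

Lemma substC j g c : subst j g c%:MP = c%:MP.
Proof. exact: comp_mpolyC. Qed.

Lemma substX j g i : subst j g 'X_i = if i == j then g else 'X_i.
Proof. by rewrite /subst comp_mpolyXU -tnth_nth tnth_mktuple. Qed.

Lemma subst_sub_dvd j g p : exists q, p - subst j g p = q * ('X_j - g).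
Proof.
elim/mpoly_ring_ind: p => [c|i|p q [u pE] [v qE]|p q [u pE] [v qE]].
- by exists 0; rewrite substC subrr mul0r.
- rewrite substX; case: eqP => [->|_]; first by exists 1; rewrite mul1r.
  by exists 0; rewrite subrr mul0r.
- by exists (u + v); rewrite rmorphD opprD addrACA pE qE mulrDl.
(* Writing p' and q' for the substituted polynomials, pq - p'q' = (p - p')q + p'(q - q'). *)
- exists (u * q + subst j g p * v); rewrite rmorphM mulrDl -mulrA.
  by rewrite (mulrC q) mulrA -pE -mulrA -qE mulrBl mulrBr addrA subrK.
Qed.

(** The factor theorem. The hypothesis holds when [g] is free of ['X_j]; it makes the substitution
    kill ['X_j - g]. *)
Lemma subst_eq0P j g p : subst j g g = g ->
  reflect (exists q, p = q * ('X_j - g)) (subst j g p == 0).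
Proof.
move=> gE; apply: (iffP eqP) => [p0|[q ->]].
  by have [q] := subst_sub_dvd j g p; rewrite p0 subr0; exists q.
by rewrite rmorphM rmorphB /= substX eqxx gE subrr mulr0.
Qed.

(** The factors split off one at a time: the substitution for a new factor kills [p] but none of the
    factors already removed, so in a domain it kills the remaining quotient. *)
Lemma prod_linear_dvd (I : eqType) (s : seq I) (v : I -> 'I_n)
    (g : I -> {mpoly K[n]}) p :
    uniq s ->
    {in s, forall t, subst (v t) (g t) (g t) = g t} ->
    {in s &, forall t u, t != u -> subst (v t) (g t) ('X_(v u) - g u) != 0} ->
    {in s, forall t, subst (v t) (g t) p = 0} ->
  exists q, p = q * \prod_(t <- s) ('X_(v t) - g t).
Proof.
elim: s => [|t s IHs] /=; first by exists p; rewrite big_nil mulr1.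
case/andP=> ts us gE gne p0.
have [u su|u w su sw|u su|q pE] := IHs us.
- by apply: gE; rewrite inE su orbT.
- by apply: gne; rewrite inE ?su ?sw orbT.
- by rewrite p0 // inE su orbT.
have st : t \in t :: s by rewrite inE eqxx.
have : subst (v t) (g t) q == 0.
  move/eqP: (p0 _ st); rewrite pE rmorphM mulf_eq0 => /orP[//|].
  rewrite rmorph_prod prodf_seq_eq0 => /hasP[u su /= /negPn /negP[]].
  apply: gne => //; first by rewrite inE su orbT.
  by apply: contraNneq ts => ->.
case/subst_eq0P => [|q' qE]; first exact: gE.
by exists q'; rewrite big_cons mulrA -qE.
Qed.

End Substitution.

(** * Evaluation, the chain rule and homogeneous degrees *)

Section Evaluation.
Variables (n : nat) (K : idomainType).
Implicit Types (p q g : {mpoly K[n]}) (i j : 'I_n).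

Lemma mpoly_rmorph_ext (A : pzRingType)
    (F G : {rmorphism {mpoly K[n]} -> A}) :
  (forall c, F c%:MP = G c%:MP) -> (forall i, F 'X_i = G 'X_i) -> F =1 G.
Proof.
move=> FC FX; elim/mpoly_ring_ind => // p q; first by rewrite !rmorphD => -> ->.
by rewrite !rmorphM => -> ->.
Qed.

Lemma msymC s c : msym s c%:MP = c%:MP :> {mpoly K[n]}.
Proof. by rewrite /msym mmapC. Qed.

Lemma msymXU s i : msym s 'X_i = 'X_(s i) :> {mpoly K[n]}.
Proof. by rewrite /msym mmapX mmap1U. Qed.

Lemma meval_msym s p z : (msym s p).@[z] = p.@[fun i => z (s i)].
Proof.
pose F := meval z \o (msym s : {mpoly K[n]} -> _).
apply: (mpoly_rmorph_ext (F := F) (G := meval (fun i => z (s i)))) => [c|i] /=.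
  by rewrite msymC !mevalC.
by rewrite msymXU !mevalXU.
Qed.

Lemma meval_subst j g p z :
  (subst j g p).@[z] = p.@[fun i => if i == j then g.@[z] else z i].
Proof.
pose F := meval z \o subst j g.
apply: (mpoly_rmorph_ext (F := F) (G := meval _)) => [c|i] /=.
  by rewrite substC !mevalC.
by rewrite substX !mevalXU; case: eqP => // _; rewrite mevalXU.
Qed.

(** The chain rule. Both sides are additive in [p] and obey the same Leibniz rule, so constants and
    variables suffice. *)
Lemma mderiv_comp k (t : n.-tuple {mpoly K[k]}) p (j : 'I_k) :
  (p \mPo t)^`M(j) = \sum_i (p^`M(i) \mPo t) * (tnth t i)^`M(j).
Proof.
elim/mpoly_ring_ind: p => [c|i|p q IHp IHq|p q IHp IHq].
- rewrite comp_mpolyC mderivC big1 // => i _.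
  by rewrite mderivC comp_mpoly0 mul0r.
- rewrite comp_mpolyXU -tnth_nth (bigD1 i) //= big1 => [|l li].
    rewrite mderivX mnmE eqxx scale1r addr0.
    have -> : (U_(i) - U_(i) = 0 :> 'X_{1..n})%MM.
      by apply/mnmP => l; rewrite !mnmE subnn.
    by rewrite mpolyX0 rmorph1 mul1r.
  by rewrite mderivX mnmE eq_sym (negbTE li) scale0r comp_mpoly0 mul0r.
- rewrite rmorphD mderivD IHp IHq -big_split; apply: eq_bigr => i _.
  by rewrite mderivD rmorphD mulrDl.
- rewrite rmorphM mderivM IHp IHq mulr_suml mulr_sumr -big_split.
  apply: eq_bigr => i _.
  by rewrite /= mderivM rmorphD !rmorphM mulrDl mulrAC mulrA.
Qed.

Lemma det_homog m (A : 'M[{mpoly K[n]}]_m) (d : 'I_m -> nat) :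
  (forall i j : 'I_m, A i j \is (d i).-homog) -> \det A \is (\sum_i d i).-homog.
Proof.
move=> Ad; apply: rpred_sum => s _; rewrite rpredMsign.
have := @dhomog_prod n K mdeg m [tuple d i | i < m] [tuple A i (s i) | i < m].
rewrite !big_tuple (eq_bigr d) => [|i _]; last exact: tnth_mktuple.
rewrite (eq_bigr (fun k : 'I_m => A k (s k))) => [|i _];
  last exact: tnth_mktuple.
by apply=> i; rewrite !tnth_mktuple.
Qed.

Lemma mderiv_homog d i p : p \is d.+1.-homog -> p^`M(i) \is d.-homog.
Proof.
move=> pd; apply/dhomogP => m; rewrite mcoeff_msupp mcoeff_mderiv => pm.
apply/eqP; apply: contraNT pm => md.
rewrite (dhomog_nemf_coeff pd) ?mul0rn //=.
by rewrite mdegD mdeg1 addn1 eqSS.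
Qed.

Lemma msize_homog d p : p \is d.-homog -> p != 0 -> msize p = d.+1.
Proof.
move=> pd pn0; rewrite -mlead_deg //; congr _.+1.
exact: (dhomog_mf pd (mlead_supp pn0)).
Qed.

End Evaluation.

(** * Non-vanishing and interpolation in characteristic zero *)

Section NonVanishing.
Variables (n : nat) (K : numFieldType).
Implicit Types (p q : {mpoly K[n]}).

(** Otherwise [p] would be divisible by ['X_j - k] for [msize p] distinct integers k, more than its
    degree allows. *)
Lemma substC_neq0 (j : 'I_n) p : p != 0 -> exists c, subst j c%:MP p != 0.
Proof.
move=> p0; apply: contrapT => /forallNP sp0.
pose N := msize p; pose lin (k : nat) : {mpoly K[n]} := 'X_j - (k%:R)%:MP.
have linE k : (1 < msize (lin k))%N.
  rewrite -(mdeg1 j) msize_mdeg_lt // mcoeff_msupp mcoeffB mcoeffX mcoeffC eqxx.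
  by rewrite mnm1_eq0 mulr0 subr0 oner_eq0.
have lin0 k : lin k != 0 by rewrite -msize_poly_eq0 -lt0n ltnW.
have prod_size s : (size s < msize (\prod_(k <- s) lin k))%N /\
    \prod_(k <- s) lin k != 0.
  elim: s => [|k s [IHs IHs0]]; first by rewrite big_nil msize1 oner_eq0.
  rewrite big_cons mulf_neq0 // msizeM //; split=> //=.
  move: (linE k) IHs; move: (msize _) (msize _) => x y; lia.
have [||t u _ _ tu|t _|q pE] := @prod_linear_dvd n K nat (iota 0 N)
    (fun=> j) (fun k => (k%:R)%:MP) p.
- exact: iota_uniq.
- by move=> t _; rewrite substC.
- by rewrite rmorphB /= substX eqxx substC -mpolyCB mpolyC_eq0 subr_eq0 eqr_nat.
- by apply/eqP/negPn/negP; apply: sp0.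
change (p = q * \prod_(k <- iota 0 N) lin k) in pE.
have q0 : q != 0 by apply: contraNneq p0 => q0; rewrite pE q0 mul0r.
have [sz pr0] := prod_size (iota 0 N); rewrite size_iota in sz.
have := congr1 (fun r => msize r) pE; rewrite msizeM // => NE.
move: (msize_poly_eq0 q) sz NE; rewrite -/N (negbTE q0).
by move: (msize q) => x; move: (msize _) => y; lia.
Qed.

Lemma meval_neq0 p : p != 0 -> exists z, p.@[z] != 0.
Proof.
move=> p0.
(* The variables are specialised one by one; those outside the list stay free. *)
have [z] : exists z, p \mPo [tuple if i \in enum 'I_n then (z i)%:MP else 'X_i
    | i < n] != 0.
  elim: (enum _) => [|j l [z IHl]].
    exists (fun=> 0); suff -> : [tuple if i \in [::] then 0%:MP else 'X_i
      | i < n] = [tuple 'X_i | i < n] :> n.-tuple {mpoly K[n]} by rewrite comp_mpoly_id.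
    by apply: eq_from_tnth => i; rewrite !tnth_mktuple.
  have [c] := substC_neq0 j IHl; set q := _ \mPo _ => cn0.
  exists (fun i => if i \in l then z i else c).
  suff <- : subst j c%:MP q = p \mPo
    [tuple if i \in j :: l then (if i \in l then z i else c)%:MP else 'X_i
      | i < n] by [].
  pose F := subst j c%:MP \o comp_mpoly [tuple if i \in l then (z i)%:MP
    else 'X_i | i < n].
  apply: (mpoly_rmorph_ext (F := F) (G := comp_mpoly _)) => [b|i] /=.
    by rewrite !comp_mpolyC substC.
  rewrite !comp_mpolyXU -!tnth_nth !tnth_mktuple inE.
  case: ifP => _; first by rewrite orbT substC.
  by rewrite substX orbF; case: eqP.
move=> pz; exists z; apply: contraNneq pz => pz0.
rewrite -(mpolyC0 n) -pz0; apply/eqP.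
apply: (mpoly_rmorph_ext (F := comp_mpoly _) (G := @mpolyC n K \o meval z)).
  by move=> c /=; rewrite comp_mpolyC mevalC.
by move=> i /=; rewrite comp_mpolyXU -tnth_nth tnth_mktuple mem_enum mevalXU.
Qed.

Lemma perm_fix_others (T : finType) (a b : T) (s : {perm T}) :
  (forall x, x != a -> x != b -> s x = x) -> s = 1%g \/ s = tperm a b.
Proof.
move=> sfix.
have sab x : s x \in [set a; b] -> x \in [set a; b].
  rewrite !inE; apply: contraLR; rewrite !negb_or => /andP[xa xb].
  by rewrite sfix // xa.
have sab' x : x \in [set a; b] -> s x \in [set a; b].
  move=> xab; have /eqP/setP/(_ x) : s @^-1: [set a; b] == [set a; b].
    rewrite eqEcard card_preimset ?leqnn ?andbT; last exact: perm_inj.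
    by apply/subsetP=> y; rewrite inE; apply: sab.
  by rewrite inE xab.
have := sab' a; have := sab' b; rewrite !inE !eqxx orbT.
case: (eqVneq (s a) a) => [sa _ _|saa /= /(_ isT) sb /(_ isT) /eqP sa].
  left; apply/permP => x; rewrite perm1.
  have [->|xa] := eqVneq x a; first by [].
  have [->|xb] := eqVneq x b; last exact: sfix.
  have := sab' b; rewrite !inE eqxx orbT => /(_ isT) /orP[] /eqP //.
  by rewrite -{1}sa => /perm_inj ba; rewrite ba sa.
right; apply/permP => x; case: tpermP => [->|->|/eqP xa /eqP xb] //;
  last exact: sfix.
case/orP: sb => [/eqP//|/eqP sb]; move: saa; rewrite sa -{1}sb => /negP[].
by apply/eqP; apply: (@perm_inj _ s); rewrite sa sb.
Qed.

Lemma perm_two_points (T : finType) (a b c d : T) : a != b -> c != d ->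
  exists s : {perm T}, s a = c /\ s b = d.
Proof.
move=> ab cd; pose t := tperm a c; exists (t * tperm (t b) d)%g.
split; rewrite permM; last exact: tpermL.
rewrite {2}/t tpermL tpermD //; last by rewrite eq_sym.
by rewrite -(tpermL a c) -/t (inj_eq (@perm_inj _ t)) eq_sym.
Qed.

(** [u] is the product of all X_i - z_j with i outside {a, b} and j different from i. A permutation
    s other than 1 and (a b) moves some such i, and the factor with j = s i vanishes. *)
Lemma interpolation (a b : 'I_n) (z : 'I_n -> K) :
    (forall i j, i != a -> i != b -> j != i -> z i != z j) ->
  exists u : {mpoly K[n]}, u.@[z] != 0 /\
    forall s : 'S_n, s != 1%g -> s != tperm a b -> u.@[fun i => z (s i)] = 0.
Proof.
move=> zne; exists (\prod_(i | (i != a) && (i != b)) \prod_(j | j != i)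
  ('X_i - (z j)%:MP)).
have uE w : (\prod_(i | (i != a) && (i != b)) \prod_(j | j != i)
    ('X_i - (z j)%:MP)).@[w] =
    \prod_(i | (i != a) && (i != b)) \prod_(j | j != i) (w i - z j).
  rewrite rmorph_prod; apply: eq_bigr => i _; rewrite rmorph_prod.
  by apply: eq_bigr => j _; rewrite rmorphB /= mevalXU mevalC.
split=> [|s s1 st]; rewrite uE.
  apply/prodf_neq0 => i /andP[ia ib]; apply/prodf_neq0 => j ji.
  by rewrite subr_eq0 zne.
have [i /and3P[ia ib si]] : exists i, [&& i != a, i != b & s i != i].
  apply/existsP; apply: contraT => /existsPn sfix; exfalso.
  have [x xa xb||] := @perm_fix_others _ a b s.
  - by move: (sfix x); rewrite xa xb negbK => /eqP.
  - exact/eqP.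
  - exact/eqP.
rewrite (bigD1 i) ?ia //= (bigD1 (s i)) //= subrr mul0r.
by rewrite mul0r.
Qed.

End NonVanishing.

(** * The Jacobian and the discriminant *)

Section Jacobian.
Variables (n : nat) (K : numFieldType).
Implicit Types (p q : {mpoly K[n]}) (i j : 'I_n).

Definition vdm : {mpoly K[n]} :=
  \prod_(t : 'I_n * 'I_n | (t.1 < t.2)%N) ('X_t.2 - 'X_t.1).

Lemma mpolyXU_inj i j : 'X_i = 'X_j :> {mpoly K[n]} -> i = j.
Proof.
move/(congr1 (mcoeff U_(i))); rewrite !mcoeffX eqxx eq_mnm1.
by case: (eqVneq j i) => // _ /eqP; rewrite oner_eq0.
Qed.

Lemma vdm_neq0 : vdm != 0.
Proof.
apply/prodf_neq0 => -[i j] /= ij; rewrite subr_eq0.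
by apply: contraTneq ij => /mpolyXU_inj ->; rewrite ltnn.
Qed.

(** The order inside each pair excludes the reversed pair, which would define the same hyperplane.
    This is the coprimality needed for [prod_linear_dvd]. *)
Lemma subst_sub_neq0 (t u : 'I_n * 'I_n) :
    (t.1 < t.2)%N -> (u.1 < u.2)%N -> t != u ->
  subst t.2 'X_t.1 ('X_u.2 - 'X_u.1 : {mpoly K[n]}) != 0.
Proof.
move=> tt uu; apply: contra_neq => /eqP.
rewrite rmorphB /= !substX subr_eq0 => /eqP.
case: t u tt uu => [a b] [a' b'] /= ab ab'.
have [b'b|_] := eqVneq b' b; have [a'b|_] := eqVneq a' b => /mpolyXU_inj E.
- by move: ab'; rewrite a'b b'b ltnn.
- by rewrite b'b E.
- by move: ab ab'; rewrite a'b E; lia.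
- by move: ab'; rewrite E ltnn.
Qed.

Lemma det_Vandermonde_vdm :
  \det (Vandermonde n (\row_i ('X_i : {mpoly K[n]}))) = vdm.
Proof.
rewrite det_Vandermonde /vdm pair_big_dep /=.
by apply: eq_bigr => t _; rewrite !mxE.
Qed.

Lemma vdm_homog : vdm \is (\sum_(i < n) i).-homog.
Proof.
rewrite -det_Vandermonde_vdm; apply: det_homog => i j; rewrite !mxE.
rewrite -[X in X.-homog]mul1n; apply: dhomogMn.
by rewrite dhomogX /= mdeg1.
Qed.

Definition power_sum k : {mpoly K[n]} := \sum_i 'X_i ^+ k.

Lemma power_sum_sym k : power_sum k \is symmetric.
Proof.
apply/issymP => s; rewrite rmorph_sum [RHS](reindex_inj (@perm_inj _ s)).
by apply: eq_bigr => i _; rewrite rmorphXn /= msymXU.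
Qed.

Lemma mderiv_power_sum k j : (power_sum k.+1)^`M(j) = 'X_j ^+ k *+ k.+1.
Proof.
have dX l : ('X_j ^+ l.+1 : {mpoly K[n]})^`M(j) = 'X_j ^+ l *+ l.+1.
  have dX1 : ('X_j : {mpoly K[n]})^`M(j) = 1.
    have := @mderivX n K j U_(j); rewrite mnmE eqxx scale1r => ->.
    by rewrite -mpolyX0; congr 'X_[_]; apply/mnmP => i; rewrite !mnmE subnn.
  elim: l => [|l IHl]; first by rewrite expr1 expr0 dX1.
  by rewrite exprS mderivM IHl dX1 mul1r mulrnAr -exprS [RHS]mulrS.
rewrite /power_sum raddf_sum (bigD1 j) //= dX big1 ?addr0 // => i ij.
have dX0 : ('X_i : {mpoly K[n]})^`M(j) = 0.
  by have := @mderivX n K j U_(i); rewrite mnmE (negbTE ij) scale0r.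
elim: k => [|k IHk]; first by rewrite expr1.
by rewrite exprS mderivM IHk dX0 mul0r mulr0 addr0.
Qed.

Variables (f : 'I_n -> sympoly n K) (hf : basic_invariants f).

Lemma jacobian_homog : jacobian f \is (\sum_(i < n) i).-homog.
Proof.
by apply: det_homog => i j; rewrite mxE; apply: mderiv_homog; case: hf.
Qed.

(* The power sums are polynomials in the [f i]; by the chain rule, the Jacobian
   of the [f i] divides that of the power sums, which is [n! * vdm]. *)
Lemma jacobian_vdm : exists2 c, c != 0 & jacobian f = c *: vdm.
Proof.
have [_ gen] := hf.
pose P i := Sympoly (power_sum_sym i.+1).
have [q qE] := choice (fun i => gen (P i)).
pose t := [tuple (f i : {mpoly K[n]}) | i < n].
pose Q := \matrix_(i < n, j < n) ((q i)^`M(j) \mPo t).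
pose D := diag_mx (\row_(i < n) (i.+1%:R : {mpoly K[n]})).
have QE : Q *m \matrix_(i < n, j < n) (f i : {mpoly K[n]})^`M(j) =
    D *m Vandermonde n (\row_i 'X_i).
  apply/matrixP => i j; rewrite mul_diag_mx !mxE mulrC mulr_natr.
  rewrite -mderiv_power_sum -[power_sum _]/(P i : {mpoly K[n]}) qE mderiv_comp.
  by apply: eq_bigr => k _; rewrite !mxE tnth_mktuple.
have := congr1 determinant QE.
rewrite !det_mulmx det_Vandermonde_vdm det_diag -/(jacobian f).
set d := \det Q; set m := \prod_i _ => dE.
pose c : K := \prod_(i < n) i.+1%:R.
have mE : m = c%:MP.
  rewrite /m /c rmorph_prod; apply: eq_bigr => i _.
  by rewrite mxE /= mpolyC_nat.
have c0 : c != 0 by apply/prodf_neq0 => i _; rewrite pnatr_eq0.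
have cv0 : c *: vdm != 0 by rewrite scaler_eq0 negb_or c0 vdm_neq0.
rewrite mE mul_mpolyC in dE.
have [d0 j0] : d != 0 /\ jacobian f != 0.
  by apply/andP; rewrite -negb_or -mulf_eq0 dE.
(* The Jacobian and [vdm] are homogeneous of the same degree, so the cofactor [d] is a nonzero
   constant. *)
have := congr1 (fun r => msize r) dE; rewrite msizeM //.
rewrite msizeZ // (msize_homog jacobian_homog) // (msize_homog vdm_homog)
  ?vdm_neq0 //.
rewrite addnS /= -[X in _ = X]add1n => /addIn /eqP /msize_poly1P [e e0 dE'].
exists (e^-1 * c); first by rewrite mulf_neq0 ?invr_eq0.
by rewrite -scalerA -dE dE' mul_mpolyC scalerA mulVf // scale1r.
Qed.

Lemma jacobian_neq0 : jacobian f != 0.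
Proof.
have [c c0 ->] := jacobian_vdm.
by rewrite scaler_eq0 negb_or c0 vdm_neq0.
Qed.

(** Up to a nonzero scalar J is a product of pairwise coprime linear forms, each of which divides
    [p]. *)
Lemma jacobian_dvd p :
  (forall i j, i != j -> subst j 'X_i p = 0) -> p \in principal (jacobian f).
Proof.
move=> p0; have [c c0 jE] := jacobian_vdm.
have neqt (t : 'I_n * 'I_n) : (t.1 < t.2)%N -> t.1 != t.2.
  by apply: contraTneq => ->; rewrite ltnn.
have [||t u|t|q pE] := @prod_linear_dvd n K _
  (enum [pred t : 'I_n * 'I_n | (t.1 < t.2)%N]) snd (fun t => 'X_t.1) p.
- exact: enum_uniq.
- by move=> t; rewrite mem_enum inE => /neqt tt; rewrite substX (negbTE tt).
- by rewrite !mem_enum !inE; apply: subst_sub_neq0.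
- by rewrite mem_enum inE => /neqt /p0.
apply/principalP; exists (c^-1 *: q); rewrite pE jE -scalerAl -scalerAr scalerA.
by rewrite mulVf // scale1r /vdm big_enum.
Qed.

End Jacobian.

(** * Symmetry, restriction to hyperplanes and divisibility *)

Section Divisibility.
Variables (n : nat) (K : numFieldType).
Implicit Types (p q : {mpoly K[n]}) (i j : 'I_n).

Lemma subst_msym (s : 'S_n) i j p :
  subst (s j) 'X_(s i) (msym s p) = msym s (subst j 'X_i p).
Proof.
pose F := subst (s j) 'X_(s i) \o (msym s : {mpoly K[n]} -> {mpoly K[n]}).
pose G := (msym s : {mpoly K[n]} -> {mpoly K[n]}) \o subst j 'X_i.
apply: (mpoly_rmorph_ext (F := F) (G := G)) => [c|k] /=.
  by rewrite substC !msymC substC.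
rewrite msymXU !substX (inj_eq (@perm_inj _ s)).
by case: eqP => _; rewrite msymXU.
Qed.

Lemma subst_tperm i j p : subst j 'X_i (msym (tperm i j) p) = subst j 'X_i p.
Proof.
pose F := subst j 'X_i \o (msym (tperm i j) : {mpoly K[n]} -> {mpoly K[n]}).
apply: (mpoly_rmorph_ext (F := F) (G := subst j 'X_i)) => [c|k] /=.
  by rewrite msymC.
rewrite msymXU !substX; by case: tpermP => [->|->|//]; rewrite eqxx; case: ifP.
Qed.

(** Permutations act transitively on ordered pairs of distinct indices, so every hyperplane x_i =
    x_j can be moved to x_a = x_b. *)
Lemma subst_orbit_eq0 (a b : 'I_n) p : a != b ->
    (forall s, subst b 'X_a (msym s p) = 0) ->
  forall i j, i != j -> subst j 'X_i p = 0.
Proof.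
move=> ab p0 i j ij.
have [s [si sj]] := perm_two_points ij ab.
have := p0 s; rewrite -sj -si subst_msym => /(congr1 (msym s^-1%g)).
by rewrite -msymMm mulgV msym1m msym0.
Qed.

(** The transposition acts trivially on x_i = x_j, so the restriction of [p] is its own opposite,
    and 2 is invertible. *)
Lemma subst_antisym i j p : msym (tperm i j) p = - p -> subst j 'X_i p = 0.
Proof.
move=> pN; have := subst_tperm i j p; rewrite pN rmorphN => /eqP.
rewrite -subr_eq0 -opprD oppr_eq0 -mulr2n -scaler_nat scaler_eq0.
by rewrite (pnatr_eq0 K 2) /= => /eqP.
Qed.

(** Keeps a linear relation nontrivial on the hyperplane. The common factor ['X_b - 'X_a] is divided
    out repeatedly; this ends because a fixed nonzero entry loses degree each time. *)
Lemma subst_primitive (a b : 'I_n) r (y : 'rV[{mpoly K[n]}]_r) :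
    a != b -> y != 0 ->
  exists y' : 'rV_r, (exists2 g, g != 0 & y = g *: y') /\
    exists k, subst b 'X_a (y' 0 k) != 0.
Proof.
move=> ab y0; have [j yj0] : exists k, y 0 k != 0.
  apply: contrapT => /forallNP yz; case/negP: y0; apply/eqP/rowP => j.
  by rewrite mxE; apply/eqP/negPn/negP/yz.
have [m] := ubnP (msize (y 0 j)); elim: m y yj0 {y0} => // m IHm y yj0 ym.
have [[l yl]|/forallNP yz] := pselect (exists l, subst b 'X_a (y 0 l) != 0).
  exists y; split; last by exists l.
  by exists 1; rewrite ?oner_eq0 ?scale1r.
have dv l : exists q, y 0 l = q * ('X_b - 'X_a).
  apply/subst_eq0P; last exact/negPn/negP/yz.
  by rewrite substX (negbTE ab).
have [Q QE] := choice dv.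
pose L : {mpoly K[n]} := 'X_b - 'X_a.
have L0 : L != 0.
  by rewrite subr_eq0; apply: contraNneq ab => /mpolyXU_inj ->.
have L2 : msize L = 2.
  by apply: msize_homog => //; rewrite rpredB // dhomogX /= mdeg1.
have Q0 : Q j != 0 by apply: contraNneq yj0 => Qj; rewrite QE Qj mul0r.
have [||y' [[g g0 qE'] y'E]] := IHm (\row_l Q l).
- by rewrite mxE.
- by move: ym; rewrite mxE QE -/L msizeM // L2 addn2.
exists y'; split=> //; exists (L * g); first exact: mulf_neq0.
rewrite -scalerA -qE'; apply/rowP => l.
by rewrite !mxE QE mulrC.
Qed.

Variables (f : 'I_n -> sympoly n K).

Lemma subst_jacobian i j : i != j -> subst j 'X_i (jacobian f) = 0.
Proof.
by move=> ij; apply: subst_antisym; rewrite msym_jacobian odd_tperm ij mulN1r.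
Qed.

Hypothesis hf : basic_invariants f.

(** [h] collects the other factors of J; its non-zeros are the generic points to which
    [interpolation] applies. *)
Lemma jacobian_cofactor (a b : 'I_n) : (a < b)%N ->
  exists h, [/\ jacobian f = h * ('X_b - 'X_a), subst b 'X_a h != 0 &
    forall z, h.@[z] != 0 ->
      forall i j, i != a -> i != b -> j != i -> z i != z j].
Proof.
move=> ltab; have ab : a != b by apply: contraTneq ltab => ->; rewrite ltnn.
have [c c0 jE] := jacobian_vdm hf.
pose h : {mpoly K[n]} := c *: \prod_(t : 'I_n * 'I_n |
  (t.1 < t.2)%N && (t != (a, b))) ('X_t.2 - 'X_t.1).
have hE : jacobian f = h * ('X_b - 'X_a).
  by rewrite jE /vdm (bigD1 (a, b)) //= mulrC scalerAl.
exists h; split=> // [|z hz i j ia ib ji].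
  rewrite /h -mul_mpolyC rmorphM rmorph_prod /= substC mulf_neq0 ?mpolyC_eq0 //.
  apply/prodf_neq0 => t /andP[tt tab].
  by apply: (@subst_sub_neq0 n K (a, b)); rewrite // eq_sym.
(* J vanishes on x_i = x_j, whereas ['X_b - 'X_a] is not identically zero there since i is neither a
   nor b. Hence [h] vanishes on it, in particular at z. *)
apply: contraNneq hz => zij.
have := subst_jacobian (i := i) (j := j); rewrite eq_sym ji => /(_ isT) /eqP.
rewrite hE rmorphM mulf_eq0 => /orP[/eqP h0|]; last first.
  rewrite rmorphB /= !substX subr_eq0 => /eqP.
  have [<-|bj] := eqVneq b j.
    by rewrite (negbTE ab) => /mpolyXU_inj ia'; rewrite ia' eqxx in ia.
  have [aj|aj] := eqVneq a j => /mpolyXU_inj E; first by rewrite E eqxx in ib.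
  by rewrite E eqxx in ab.
have := meval_subst j 'X_i h z; rewrite h0 meval0 => /esym/eqP.
rewrite (meval_eq (v2 := z)) // => k; rewrite mevalXU.
by case: eqP => // ->.
Qed.

(** Symmetry spreads the vanishing to all hyperplanes, so J divides [r]. The quotient is
    antisymmetric, hence again divisible by J, and the second quotient is symmetric. *)
Lemma discriminant_dvd (a b : 'I_n) (r : sympoly n K) : a != b ->
  subst b 'X_a (r : {mpoly K[n]}) = 0 -> r \in principal (discriminant f).
Proof.
move=> ab r0.
have /principalP[q rE] : (r : {mpoly K[n]}) \in principal (jacobian f).
  apply: (jacobian_dvd hf); apply: (subst_orbit_eq0 ab) => s.
  by rewrite msym_sympoly.
have J0 := jacobian_neq0 hf.
have qs s : msym s q = (-1) ^+ s * q.
  apply: (mulIf J0); apply: (@mulfI _ ((-1) ^+ s)); first by rewrite signr_eq0.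
  have := msym_sympoly s r; rewrite rE msymM msym_jacobian => qE.
  by rewrite !mulrA -expr2 sqrr_sign mul1r -[RHS]qE mulrCA mulrA.
have /principalP[q' qE] : q \in principal (jacobian f).
  apply: (jacobian_dvd hf) => i j ij; apply: subst_antisym.
  by rewrite qs odd_tperm ij mulN1r.
have rE' : (r : {mpoly K[n]}) = jacobian f ^+ 2 * q'.
  by rewrite rE qE expr2 mulrC mulrA mulrAC mulrC mulrA.
have q's : q' \is symmetric.
  apply: (msymMK (p := jacobian f ^+ 2)); rewrite ?expf_neq0 //.
    exact: discriminant_sym.
  by rewrite -rE'; apply: (valP r).
apply/principalP; exists (Sympoly q's); apply: val_inj.
by rewrite /= rE' mulrC.
Qed.

End Divisibility.

(** * Linear dependence over an integral domain *)

Section Kernel.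
Variable D : idomainType.
Local Open Scope quotient_scope.

Lemma fraction_denom (x : {fraction D}) :
  exists dc : D * D, dc.1 != 0 /\
    x * FracField.tofrac dc.1 = FracField.tofrac dc.2.
Proof.
elim/quotW: x => x; exists (\d_x, \n_x); split; first exact: denom_ratioP.
unlock FracField.tofrac; rewrite -[RHS]/(\pi _) !piE.
apply/eqP; rewrite FracField.equivf_def /FracField.mulf.
rewrite !numden_Ratio ?oner_eq0 ?mulf_neq0 ?denom_ratioP ?mulr1 ?oner_eq0 //=.
by rewrite mulrC.
Qed.

(** Over the fraction field a kernel vector exists for reasons of dimension; multiplying by the
    product of its denominators brings it back to [D]. *)
Lemma idomain_left_kernel m k (X : 'M[D]_(m, k)) : (k < m)%N ->
  exists2 y : 'rV_m, y != 0 & y *m X = 0.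
Proof.
move=> km; pose Y := map_mx (@FracField.tofrac D) X.
have [w wn0 wY] : exists2 w : 'rV_m, w != 0 & w *m Y = 0.
  apply: contrapT => /forall2NP ker0.
  have : \rank (kermx Y) = 0%N.
    apply/eqP; rewrite mxrank_eq0; apply/eqP/row_matrixP => i; rewrite row0.
    have [/negP/negPn/eqP //|[]] := ker0 (row i (kermx Y)).
    by apply/sub_kermxP/row_sub.
  by have := rank_leq_col Y; rewrite mxrank_ker; lia.
have [e eP] := choice (fun j => fraction_denom (w 0 j)).
have ed0 j : (e j).1 != 0 by have [] := eP j.
pose y := \row_j ((e j).2 * \prod_(l | l != j) (e l).1).
have yE : map_mx (@FracField.tofrac D) y =
    FracField.tofrac (\prod_l (e l).1) *: w.
  apply/rowP => j; rewrite /y !mxE.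
  rewrite tofracM -(eP j).2 [in RHS](bigD1 j) //= tofracM.
  by rewrite -mulrA mulrC.
exists y.
  apply: contraNneq wn0 => y0; move: yE; rewrite y0 map_mx0 => /esym/eqP.
  rewrite scaler_eq0 tofrac_eq0 => /orP[|//].
  by move/negPn/negP; case; apply/prodf_neq0 => j _.
have yX : map_mx (@FracField.tofrac D) (y *m X) = 0.
  by rewrite map_mxM yE -scalemxAl wY scaler0.
apply/matrixP => i j; rewrite [RHS]mxE; apply/eqP; rewrite -tofrac_eq0.
by move/matrixP/(_ i j): yX; rewrite mxE [X in _ = X]mxE => ->.
Qed.

End Kernel.

(** * The rank of Hom(V, S/(J)) *)

Section Restriction.
Variables (n : nat) (K : numFieldType) (f : 'I_n -> sympoly n K).
Variables (a b : 'I_n).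
Hypothesis ab : a != b.

Local Notation pi_J := (pquot_pi (jacobian f)).

Lemma SJ_scale_pi c p : c *: (pi_J p : SJ f) = pi_J (c *: p).
Proof. by rewrite -mul_mpolyC rmorphM. Qed.

Lemma SJ_act_mul s (x y : SJ f) : SJ_act s (x * y) = SJ_act s x * SJ_act s y.
Proof.
rewrite -[x]pi_repr -[y]pi_repr -(rmorphM pi_J) !SJ_act_pi.
by rewrite -(rmorphM pi_J) msymM.
Qed.

(* Independent of the representative, as [J] vanishes on x_a = x_b. *)
Definition SJ_subst (x : SJ f) : {mpoly K[n]} := subst b 'X_a (repr x).

Lemma SJ_subst_pi p : SJ_subst (pi_J p) = subst b 'X_a p.
Proof.
apply/eqP; rewrite -subr_eq0 -rmorphB.
have /pi_eqP/principalP[q ->] := pi_repr (pi_J p).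
by rewrite rmorphM /= subst_jacobian // mulr0.
Qed.

Lemma SJ_subst_zmod_morphism : zmod_morphism SJ_subst.
Proof.
move=> x y; rewrite -[x]pi_repr -[y]pi_repr -(rmorphB pi_J) !SJ_subst_pi.
exact: rmorphB.
Qed.

HB.instance Definition _ :=
  GRing.isZmodMorphism.Build (SJ f) {mpoly K[n]} SJ_subst SJ_subst_zmod_morphism.

Lemma SJ_substZ c x : SJ_subst (c *: x) = c *: SJ_subst x.
Proof.
rewrite -[x]pi_repr SJ_scale_pi !SJ_subst_pi -!mul_mpolyC rmorphM.
by rewrite /= substC.
Qed.

Lemma SJ_subst_act x : SJ_subst (SJ_act (tperm a b) x) = SJ_subst x.
Proof.
by rewrite -[x]pi_repr SJ_act_pi !SJ_subst_pi subst_tperm.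
Qed.

Lemma subst_idem (p : {mpoly K[n]}) :
  subst b 'X_a (subst b 'X_a p) = subst b 'X_a p.
Proof.
pose F := subst b 'X_a \o subst b ('X_a : {mpoly K[n]}).
apply: (mpoly_rmorph_ext (F := F) (G := subst b 'X_a)) => [c|i] /=.
  by rewrite !substC.
rewrite substX; case: ifP => ib; first by rewrite substX (negbTE ab).
by rewrite substX ib.
Qed.

End Restriction.

(** * Lower and upper bounds for the rank *)

Section HomRank.
Variables (n : nat) (K : numFieldType) (f : 'I_n -> sympoly n K).
Variables (d : nat) (rV : mx_representation K [set: 'S_n] d).

Local Notation pi_J := (pquot_pi (jacobian f)).

(** The unnormalised average over G of the linear map sending v to (v c) p, hence a G-homomorphism
    from V to S. *)
Definition orbit_sum (c : 'cV[K]_d) (p : {mpoly K[n]}) (v : 'rV[K]_d) :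
    {mpoly K[n]} :=
  \sum_(s : 'S_n) (v *m rV s^-1%g *m c) 0 0 *: msym s p.

Lemma orbit_sum_linear c p k u v :
  orbit_sum c p (k *: u + v) = k *: orbit_sum c p u + orbit_sum c p v.
Proof.
rewrite scaler_sumr -big_split; apply: eq_bigr => s _ /=.
by rewrite !mulmxDl -!scalemxAl !mxE scalerDl scalerA.
Qed.

Lemma orbit_sum_msym c p (t : 'S_n) v :
  orbit_sum c p (v *m rV t) = msym t (orbit_sum c p v).
Proof.
rewrite rmorph_sum [LHS](reindex_inj (mulIg t)); apply: eq_bigr => s _ /=.
rewrite [RHS]msymZ msymMm invMg (repr_mxM rV (in_setT _) (in_setT _)) mulmxA.
by rewrite (repr_mxK rV (in_setT t)).
Qed.

Fact orbit_sum_subproof c p :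
  (fun v => pi_J (orbit_sum c p v) : SJ f) \in @homG_pred n K f d rV.
Proof.
apply/asboolP; split=> [k u v|s v].
  by rewrite orbit_sum_linear SJ_scale_pi rmorphD.
by rewrite orbit_sum_msym SJ_act_pi.
Qed.

Definition orbit_hom c p : homG f rV := HomG (orbit_sum_subproof c p).

Variables (a b : 'I_n).
Hypothesis ltab : (a < b)%N.

Let ab : a != b. Proof. by apply: contraTneq ltab => ->; rewrite ltnn. Qed.

(** Only the terms at 1 and (a b) survive, and (a b) fixes z because z lies on x_a = x_b. *)
Lemma meval_two_terms (u : {mpoly K[n]}) (z : 'I_n -> K)
    (F : 'S_n -> K) : z a = z b ->
    (forall s : 'S_n, s != 1%g -> s != tperm a b ->
      u.@[fun i => z (s i)] = 0) ->
  \sum_s F s * u.@[fun i => z (s i)] = (F 1%g + F (tperm a b)) * u.@[z].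
Proof.
move=> zab u0; rewrite (bigD1 1%g) //= (bigD1 (tperm a b)) /=; last first.
  by apply: contraNneq ab => /permP/(_ a); rewrite tpermL perm1 => ->.
rewrite big1 => [|s /andP[s1 st]]; last by rewrite u0 ?mulr0.
rewrite addr0 mulrDl; congr (_ * _ + _ * _); apply: meval_eq => i.
  by rewrite perm1.
by case: tpermP => // ->.
Qed.

Lemma meval_orbit_sum c u v z : z a = z b ->
    (forall s : 'S_n, s != 1%g -> s != tperm a b ->
      u.@[fun i => z (s i)] = 0) ->
  (orbit_sum c u v).@[z] = (v *m (1%:M + rV (tperm a b)) *m c) 0 0 * u.@[z].
Proof.
move=> zab u0; rewrite raddf_sum /=.
under eq_bigr do rewrite mevalZ meval_msym.
rewrite (meval_two_terms _ zab u0) // invg1 repr_mx1 tpermV mulmxDr mulmxDl.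
by rewrite [in RHS]mxE.
Qed.

Hypothesis hf : basic_invariants f.

Local Notation pi_D := (pquot_pi (discriminant f)).
Local Notation E := (1%:M + rV (tperm a b)).

Lemma meval_diag (p : {mpoly K[n]}) z : z a = z b ->
  (subst b 'X_a p).@[z] = p.@[z].
Proof.
move=> zab; rewrite meval_subst; apply: meval_eq => i; rewrite mevalXU.
by case: eqP => // ->.
Qed.

(** The discriminant, and so each of its multiples, vanishes wherever x_a = x_b. *)
Lemma pi_D_neq0 (r : sympoly n K) z : z a = z b ->
  (r : {mpoly K[n]}).@[z] != 0 -> pi_D r != 0.
Proof.
move=> zab; apply: contra_neq; rewrite -(raddf0 pi_D) => /pi_eqP/principalP[q].
rewrite subr0 => /(congr1 (@sympoly_val n K)) /= ->; rewrite mevalM rmorphXn /=.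
by rewrite -(meval_diag (jacobian f) zab) subst_jacobian // meval0 expr0n mulr0.
Qed.

Lemma homG_scale_val (r : sympoly n K) (phi : homG f rV) v :
  (pi_D r *: phi) v = pi_J (r : {mpoly K[n]}) * phi v.
Proof. by rewrite /= RDelta_SJ_pi. Qed.

Lemma homG_sum_val r (phi : 'I_r -> homG f rV) v :
  (\sum_i phi i) v = \sum_i phi i v.
Proof.
by elim/big_ind2: _ => // [x1 y1 x2 y2 <- <-].
Qed.

Lemma homGD (phi : homG f rV) v w : phi (v + w) = phi v + phi w.
Proof. by have := (homGP phi).1 1 v w; rewrite !scale1r. Qed.

Lemma homG_lincomb (phi : homG f rV) k (c : 'I_k -> K) w :
  phi (\sum_i c i *: w i) = \sum_i c i *: phi (w i).
Proof.
have phi0 : phi 0 = 0.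
  by apply: (addrI (phi 0)); rewrite -homGD !addr0.
elim/big_rec2: _ => // i x v _ <-.
by have := (homGP phi).1 (c i) (w i) v.
Qed.

(* For [u] interpolating at a generic point [z] of x_a = x_b and [c], [w] dual
   bases coming from a factorisation of [1 + rV (a b)], the values at [z] of the
   orbit sums form a nonzero scalar matrix. *)
Lemma homG_rank_ge : exists phi : 'I_(\rank E) -> homG f rV, lin_indep phi.
Proof.
(* The point (0, ..., n-1) with coordinate a changed to b: only the coordinates a and b coincide. *)
pose z (i : 'I_n) : K := (if i == a then b : nat else i)%:R.
have zab : z a = z b by rewrite /z eqxx eq_sym (negbTE ab).
have [|u [uz u0]] := @interpolation n K a b z.
  move=> i j ia ib ji; rewrite /z (negbTE ia) eqr_nat.
  by case: ifP => _; rewrite ?val_eqE // eq_sym.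
pose c i := col i (pinvmx (row_base E)).
pose w j := row j (pinvmx (col_base E)).
exists (fun i => orbit_hom (c i) u) => al al0 i.
have wc j k : (w j *m E *m c k) 0 0 = (j == k)%:R.
  have EE : pinvmx (col_base E) *m E *m pinvmx (row_base E) = 1%:M.
    rewrite -[X in _ *m X *m _]mulmx_base mulmxA mulVpmx ?col_base_full //.
    by rewrite mul1mx mulmxVp ?row_base_free.
  have := congr1 (fun M : 'M_ _ => M j k) EE; rewrite [RHS]mxE => <-.
  rewrite -row_mul [LHS]mxE [RHS]mxE; apply: eq_bigr => l _.
  by rewrite [row _ _ _ _]mxE [col _ _ _ _]mxE.
pose X := \matrix_(i, j) subst b 'X_a (orbit_sum (c i) u (w j)).
have detX : \det X != 0.
  suff: (\det X).@[z] != 0 by apply: contra_neq => ->; rewrite meval0.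
  rewrite -det_map_mx (_ : map_mx _ X = u.@[z]%:M).
    by rewrite det_scalar expf_neq0.
  apply/matrixP => k l; rewrite !mxE /= meval_diag // meval_orbit_sum //.
  by rewrite wc eq_sym mulr_natl.
(* Applied to each [w j] and restricted to x_a = x_b, the relation becomes y X = 0. As det X is
   nonzero, all coefficients vanish on the hyperplane, hence are divisible by the discriminant. *)
pose al' i : sympoly n K := repr (al i).
pose y := \row_i subst b 'X_a (al' i : {mpoly K[n]}).
have yX : y *m X = 0.
  apply/rowP => j; rewrite [LHS]mxE [RHS]mxE.
  have E0 : \sum_k SJ_subst a b ((al k *: orbit_hom (c k) u) (w j)) = 0.
    rewrite -raddf_sum -homG_sum_val al0; exact: raddf0.
  rewrite -[RHS]E0; apply: eq_bigr => k _; rewrite -[al k]pi_repr.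
  by rewrite homG_scale_val -(rmorphM pi_J) SJ_subst_pi // rmorphM !mxE.
have /rowP/(_ i)/eqP : \det X *: y = 0.
  by rewrite -mul_mx_scalar -mul_mx_adj mulmxA yX mul0mx.
rewrite 3!mxE mulf_eq0 (negbTE detX) /= => /eqP yi.
rewrite -[al i]pi_repr -(raddf0 pi_D); apply/pi_eqP; rewrite subr0.
exact: (discriminant_dvd hf ab).
Qed.

(** An element restricting to 0 is a multiple of ['X_b - 'X_a], and [h] supplies the rest of J. *)
Lemma SJ_mul_cofactor h (p : {mpoly K[n]}) (x : SJ f) :
    jacobian f = h * ('X_b - 'X_a) ->
  SJ_subst a b x = 0 -> pi_J (h * p) * x = 0.
Proof.
move=> hE; rewrite -[x]pi_repr SJ_subst_pi // => /eqP/subst_eq0P[|q ->].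
  by rewrite substX (negbTE ab).
rewrite -rmorphM -(raddf0 pi_J); apply/pi_eqP/principalP; exists (p * q).
by rewrite subr0 hE; ring.
Qed.

(* On x_a = x_b the transposition (a b) acts trivially, so [phi j] is determined
   there by its values on the image of [1 + rV (a b)]; too many of them satisfy a
   relation with polynomial coefficients [y]. Multiplying [y] by the cofactor [h]
   makes the relation hold modulo [J], and symmetrizing makes its coefficients
   invariant; the interpolating [u] keeps one of them nonzero. *)
Lemma homG_rank_le r (phi : 'I_r -> homG f rV) :
  lin_indep phi -> (r <= \rank E)%N.
Proof.
move=> phi_free; rewrite leqNgt; apply/negP => ltr.
pose Phi := \matrix_(j < r, k < \rank E)
  SJ_subst a b (phi j (row k (row_base E))).
have [y0 y0n0 y0Phi] := idomain_left_kernel Phi ltr.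
(* After removal of common factors ['X_b - 'X_a], some coefficient survives restriction to x_a =
   x_b. *)
have [y [[g g0 yE] [j0 yj0]]] := subst_primitive ab y0n0.
have yPhi k : \sum_j y 0 j * Phi j k = 0.
  have /matrixP/(_ 0 k) : y *m Phi = 0.
    apply/rowP => l; apply: (mulfI g0); have /rowP/(_ l) := y0Phi.
    by rewrite yE -scalemxAl [LHS]mxE => ->; rewrite !mxE mulr0.
  by rewrite [LHS]mxE [RHS]mxE.
have phi_ker v : SJ_subst a b (\sum_j pi_J (y 0 j) * phi j v) = 0.
  have psiE w : SJ_subst a b (\sum_j pi_J (y 0 j) * phi j w) =
      \sum_j subst b 'X_a (y 0 j) * SJ_subst a b (phi j w).
    rewrite raddf_sum; apply: eq_bigr => j _; rewrite -[phi j w]pi_repr.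
    by rewrite /= -(rmorphM pi_J) !SJ_subst_pi // rmorphM.
  (* [v *m E] is v plus its image under (a b); both have the same restricted value, hence the factor
     2. Expanding [v *m E] in [row_base E] gives the right-hand side. *)
  have psi2 j : SJ_subst a b (phi j v) *+ 2 =
      \sum_k (v *m col_base E) 0 k *: Phi j k.
    have <- : SJ_subst a b (phi j (v *m E)) = SJ_subst a b (phi j v) *+ 2.
      rewrite mulmxDr mulmx1 homGD raddfD /=.
      by rewrite (homGP (phi j)).2 SJ_subst_act // mulr2n.
    rewrite -{1}(mulmx_base E) mulmxA [_ *m row_base _]mulmx_sum_row.
    rewrite homG_lincomb raddf_sum; apply: eq_bigr => k _.
    by rewrite /= SJ_substZ // /Phi mxE.
  have : SJ_subst a b (\sum_j pi_J (y 0 j) * phi j v) *+ 2 == 0.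
    rewrite psiE -sumrMnl; under eq_bigr do rewrite -mulrnAr psi2 mulr_sumr.
    rewrite exchange_big big1 //= => k _; under eq_bigr do rewrite -scalerAr.
    rewrite -scaler_sumr; apply/eqP; rewrite scaler_eq0; apply/orP; right.
    rewrite (_ : \sum_i _ = subst b 'X_a (\sum_j y 0 j * Phi j k)).
      by rewrite yPhi rmorph0.
    rewrite rmorph_sum; apply: eq_bigr => j _.
    by rewrite rmorphM /= /Phi mxE /SJ_subst subst_idem.
  by rewrite -scaler_nat scaler_eq0 pnatr_eq0 => /eqP.
have [h [hE h0 hz]] := jacobian_cofactor hf ltab.
have hy0 : subst b 'X_a (h * y 0 j0) != 0.
  by rewrite rmorphM; apply: mulf_neq0 h0 yj0.
have [z0 z0P] := meval_neq0 hy0.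
(* Moving [z0] onto the hyperplane turns the value of the restricted polynomial into a value of the
   polynomial itself. *)
pose z i := if i == b then z0 a else z0 i.
have zab : z a = z b by rewrite /z eqxx (negbTE ab).
have {z0P} zP : (h * y 0 j0).@[z] != 0.
  by move: z0P; rewrite meval_subst mevalXU.
have hz0 : h.@[z] != 0 by apply: contraNneq zP => hz0; rewrite mevalM hz0 mul0r.
have [u [uz u0]] := @interpolation n K a b z (hz z hz0).
have orbit_sym (p : {mpoly K[n]}) : \sum_(s : 'S_n) msym s p \is symmetric.
  apply/issymP => t; rewrite rmorph_sum [RHS](reindex_inj (mulIg t)).
  by apply: eq_bigr => s _; rewrite msymMm.
pose A j := Sympoly (orbit_sym (h * (y 0 j * u))).
have Aphi : \sum_j pi_D (A j) *: phi j = 0.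
  apply: val_inj; apply: funext => v.
  rewrite -[LHS]/((\sum_j pi_D (A j) *: phi j) v) homG_sum_val.
  under eq_bigr do rewrite homG_scale_val /= rmorph_sum mulr_suml.
  rewrite exchange_big big1 //= => s _.
  (* Equivariance turns the sum over j into the image under s of [h * u] times the relation at v
     s^-1, and the factor [h] makes this 0 modulo J. *)
  have phis j : phi j v = SJ_act s (phi j (v *m rV s^-1%g)).
    by rewrite -(homGP (phi j)).2 (repr_mxKV rV (in_setT s)).
  under eq_bigr do rewrite phis -SJ_act_pi -SJ_act_mul mulrA rmorphM mulrAC.
  rewrite -raddf_sum /= (_ : \sum_i _ =
    pi_J (h * u) * \sum_i pi_J (y 0 i) * phi i (v *m rV s^-1%g)).
    by rewrite (SJ_mul_cofactor _ hE) ?phi_ker // raddf0.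
  rewrite mulr_sumr; apply: eq_bigr => j _; rewrite !rmorphM -!mulrA.
  by congr (_ * _); rewrite mulrA mulrC.
have := phi_free _ Aphi j0; apply/eqP/(pi_D_neq0 zab) => /=.
rewrite raddf_sum /=; under eq_bigr do rewrite meval_msym.
pose F (s : 'S_n) := (h * y 0 j0).@[fun i => z (s i)].
under eq_bigr => s _ do rewrite mulrA mevalM -/(F s).
(* The two remaining terms carry the same nonzero value of [h * y 0 j0] at z, and 2 is nonzero in
   K. *)
rewrite (meval_two_terms _ zab u0) mulf_neq0 //.
have -> : F 1%g = (h * y 0 j0).@[z] by apply: meval_eq => i; rewrite perm1.
have -> : F (tperm a b) = (h * y 0 j0).@[z].
  by apply: meval_eq => i; case: tpermP => // ->.
by rewrite -mulr2n -mulr_natr mulf_neq0 // pnatr_eq0.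
Qed.

Theorem homG_rank : has_rank (homG f rV) (\rank E).
Proof. by split; [apply: homG_rank_ge | apply: homG_rank_le]. Qed.

End HomRank.

(** * The sum of all transpositions on the Specht module *)

Section Transpositions.
Variables (n : nat) (K : numFieldType).

(** Sums over transpositions run over ordered pairs, so each transposition occurs twice, 2m = n(n-1)
    terms in all. *)
Lemma sum_pairs_neq :
  (\sum_(x : 'I_n * 'I_n | x.1 != x.2) 1 = n * n.-1)%N.
Proof.
rewrite -(pair_big_dep xpredT (fun i j : 'I_n => i != j) (fun _ _ => 1%N)) /=.
under eq_bigr => i _.
  rewrite sum1_card (eq_card (B := predC1 i)) => [|j]; last first.
    by rewrite !inE eq_sym.
  rewrite cardC1 card_ord; over.
by rewrite sum_nat_const card_ord.
Qed.

Variables (d : nat) (rV : mx_representation K [set: 'S_n] d).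

(** E = 1 + s satisfies E^2 = 2E, so E/2 is a projection, whose trace is its rank. *)
Lemma rank_add_tperm (a b : 'I_n) :
  (\rank (1%:M + rV (tperm a b))%R)%:R *+ 2 = d%:R + \tr (rV (tperm a b)).
Proof.
set E := 1%:M + _.
have EE : E *m E = 2 *: E.
  rewrite scaler_nat mulmxDr mulmx1 mulmxDl mul1mx.
  rewrite -(repr_mxM rV (in_setT _) (in_setT _)) tperm2 repr_mx1.
  by rewrite [rV _ + _]addrC -mulr2n.
have BC : row_base E *m col_base E = 2%:M.
  have C1 := mulVpmx (col_base_full E); have B1 := mulmxVp (row_base_free E).
  have : col_base E *m row_base E *m (col_base E *m row_base E) =
      2 *: (col_base E *m row_base E) by rewrite mulmx_base.
  move: (pinvmx (col_base E)) (pinvmx (row_base E)) C1 B1 => C' B'.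
  move: (col_base E) (row_base E) => C B C1 B1.
  (* Cancelling C on the left and B on the right of C B C B = 2 C B leaves B C = 2. *)
  move=> /(congr1 (fun M => C' *m M *m B')).
  rewrite -scalemxAr -scalemxAl !mulmxA C1 !mul1mx B1 scalemx1.
  by rewrite -!mulmxA B1 mulmx1.
have := mxtrace_mulC (row_base E) (col_base E).
rewrite BC mulmx_base mxtrace_scalar mulrnAC => ->.
by rewrite raddfD /= mxtrace1.
Qed.

(** All transpositions are conjugate, so the n(n-1) summands have equal traces. *)
Lemma trace_transposition (kappa : K) (a b : 'I_n) : a != b ->
    \sum_(x : 'I_n * 'I_n | x.1 != x.2) rV (tperm x.1 x.2) = kappa%:M ->
  \tr (rV (tperm a b)) *+ (n * n.-1) = kappa *+ d.
Proof.
move=> ab /(congr1 (fun M => \tr M)); rewrite mxtrace_scalar => <-.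
rewrite raddf_sum -sum_pairs_neq -sumrMnr; apply: eq_bigr => -[i j] /= ij.
have [s [<- <-]] := perm_two_points ab ij.
have sG := in_setT s; have tG := in_setT (tperm a b).
rewrite -tpermJ /conjg (repr_mxM rV (in_setT _) (in_setT _)) mxtrace_mulC.
by rewrite -(repr_mxM rV (in_setT _) (in_setT _)) -mulgA mulgV mulg1.
Qed.

End Transpositions.

(** * Arms, legs and pairs of cells on a common line *)

Section Cells.
Variable la : seq nat.

Lemma size_cells : size (cells la) = sumn la.
Proof.
rewrite size_allpairs_dep; congr sumn.
by apply: (@eq_from_nth _ 0%N) => [|i]; rewrite size_map size_iota // => il;
  rewrite (nth_map 0%N) ?size_iota // nth_iota // size_iota.
Qed.

Lemma uniq_cells : uniq (cells la).
Proof.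
apply: allpairs_uniq_dep => [|i _|[i j] [i' j'] _ _ [-> ->]] //;
  exact: iota_uniq.
Qed.

Lemma mem_cells i j :
  ((i, j) \in cells la) = (i < size la)%N && (j < nth 0 la i)%N.
Proof.
apply/allpairsPdep/idP => [[i' [j' []]]|/andP[il jl]].
  by rewrite !mem_iota => /= il jl [-> ->]; rewrite il jl.
by exists i, j; rewrite !mem_iota.
Qed.

(** Row lengths decrease, so row i reaches every column that the lower row i' reaches. *)
Lemma cells_corner i j i' j' : sorted geq la ->
    (i, j) \in cells la -> (i', j') \in cells la -> (i < i')%N ->
  (i, j') \in cells la.
Proof.
move=> la_sorted; rewrite !mem_cells => /andP[-> _] /andP[i'l j'l] ii' /=.
apply: leq_trans j'l _.
have geq_trans : transitive geq by move=> y x z xy yz; apply: leq_trans yz xy.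
apply: (sorted_leq_nth geq_trans leqnn 0%N la_sorted) => //; last exact: ltnW.
by rewrite inE (ltn_trans ii').
Qed.

(** [g] names the line of a cell and [h] its position there. An ordered pair of distinct cells on a
    line is increasing or decreasing in [h], and swapping exchanges the two kinds. *)
Lemma sum_same_line (g h : nat * nat -> nat) :
    (forall c c', g c = g c' -> h c = h c' -> c = c') ->
  (\sum_(c <- cells la) count (fun c' => (g c' == g c) && (c' != c))
     (cells la) = 2 * \sum_(c <- cells la)
     count (fun c' => (g c' == g c) && (h c < h c')) (cells la))%N.
Proof.
move=> gh; rewrite mul2n -addnn.
under [in RHS]eq_bigr do rewrite -sum1_count.
rewrite {2}(exchange_big_dep xpredT) //= -big_split /=.
apply: eq_bigr => c _; rewrite !sum1_count -count_predUI.
rewrite [X in (_ + X)%N](_ : _ = 0%N) ?addn0; last first.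
  by apply/eqP; rewrite -leqn0 leqNgt -has_count; apply/hasPn => c' _ /=; lia.
apply: eq_count => c' /=; rewrite [g c == _]eq_sym; case: eqP => //= gc.
rewrite -neq_ltn eq_sym; congr (~~ _); apply/eqP/eqP => [->//|hc].
by apply: gh.
Qed.

Lemma same_line_ordinals n (g : nat * nat -> nat) : size (cells la) = n ->
  let cell k := nth (0%N, 0%N) (cells la) k in
  (\sum_(x : 'I_n * 'I_n | (x.1 != x.2) && (g (cell x.1) == g (cell x.2))) 1 =
   \sum_(c <- cells la) count (fun c' => (g c' == g c) && (c' != c))
     (cells la))%N.
Proof.
move=> <- cell; rewrite (big_nth (0%N, 0%N)) big_mkord.
rewrite -(pair_big_dep xpredT (fun i j : 'I_(size (cells la)) => (i != j) &&
  (g (cell i) == g (cell j))) (fun _ _ => 1%N)) /=.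
apply: eq_bigr => i _; rewrite -sum1_count (big_nth (0%N, 0%N)) big_mkord.
apply: eq_bigl => j; rewrite (nth_uniq _ _ _ uniq_cells) // andbC.
by congr (_ && ~~ _); apply: eq_sym.
Qed.


Lemma total_armlength_pairs n : size (cells la) = n ->
  let cell k := nth (0%N, 0%N) (cells la) k in
  (\sum_(x : 'I_n * 'I_n | (x.1 != x.2) && ((cell x.1).1 == (cell x.2).1)) 1 =
   2 * total_armlength la)%N.
Proof.
move=> sz /=; rewrite (same_line_ordinals fst sz) (@sum_same_line fst snd) //.
by move=> [i j] [i' j'] /= -> ->.
Qed.

Lemma total_footlength_pairs n : size (cells la) = n ->
  let cell k := nth (0%N, 0%N) (cells la) k in
  (\sum_(x : 'I_n * 'I_n | (x.1 != x.2) && ((cell x.1).2 == (cell x.2).2)) 1 =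
   2 * total_footlength la)%N.
Proof.
move=> sz /=; rewrite (same_line_ordinals snd sz) (@sum_same_line snd fst) //.
by move=> [i j] [i' j'] /= -> ->.
Qed.

End Cells.

(** * The Young symmetrizer as an eigenvector of the sum of transpositions *)

Section Content.
Variables (n : nat) (K : numFieldType) (la : seq nat).
Hypothesis hla : is_partition n la.

Local Notation G := [set: 'S_n]%G.
Local Notation rG := (regular_repr K G).
Local Notation cell k := (nth (0%N, 0%N) (cells la) k).
Local Notation P := (row_stab n la).
Local Notation Q := (col_stab n la).

Let size_cellsE : size (cells la) = n.
Proof. by rewrite size_cells; case/and3P: hla => _ _ /eqP. Qed.

Definition group_basis (s : 'S_n) : 'rV[K]_#|G| := delta_mx 0 (gring_index G s).

Lemma group_basis_mul s t : group_basis s *m rG t = group_basis (s * t)%g.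
Proof. by rewrite /group_basis -rowE rowK gring_indexK // in_setT. Qed.

Lemma row_stabM s t : s \in P -> ((s * t)%g \in P) = (t \in P).
Proof.
rewrite !inE => /forallP sP; apply/forallP/forallP => tP k.
  have := tP (s^-1%g k); rewrite permM permKV => /eqP ->.
  by have := sP (s^-1%g k); rewrite permKV eq_sym.
by rewrite permM (eqP (tP _)).
Qed.

Lemma col_stabM s t : s \in Q -> ((t * s)%g \in Q) = (t \in Q).
Proof.
rewrite !inE => /forallP sQ; apply/forallP/forallP => tQ k.
  by have := tQ k; rewrite permM (eqP (sQ _)).
by rewrite permM (eqP (sQ _)).
Qed.

Lemma tperm_row_stab (i j : 'I_n) :
  (cell i).1 = (cell j).1 -> tperm i j \in P.
Proof.
move=> ij; rewrite inE; apply/forallP => k.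
by case: tpermP => [->|->|]; rewrite ?ij.
Qed.

Lemma tperm_col_stab (i j : 'I_n) :
  (cell i).2 = (cell j).2 -> tperm i j \in Q.
Proof.
move=> ij; rewrite inE; apply/forallP => k.
by case: tpermP => [->|->|]; rewrite ?ij.
Qed.

(** With t between the column and the row part, row permutations to its right are absorbed and
    column permutations to its left come out as signs. *)
Definition twisted_symmetrizer (t : 'S_n) : 'rV[K]_#|G| :=
  \sum_(p in P) \sum_(q in Q) (-1) ^+ q *: group_basis (q * t * p)%g.

Lemma twisted_symmetrizer1 : twisted_symmetrizer 1%g = young_symmetrizer n K la.
Proof.
by apply: eq_bigr => p _; apply: eq_bigr => q _; rewrite mulg1.
Qed.

Lemma twisted_symmetrizer_row t p :
  p \in P -> twisted_symmetrizer (t * p)%g = twisted_symmetrizer t.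
Proof.
move=> pP; rewrite [RHS](reindex_inj (mulgI p)) /=.
apply: eq_big => [s|s _]; first by rewrite row_stabM.
by apply: eq_bigr => q _; rewrite !mulgA.
Qed.

Lemma twisted_symmetrizer_col t q :
  q \in Q -> twisted_symmetrizer (q * t)%g = (-1) ^+ q *: twisted_symmetrizer t.
Proof.
move=> qQ; rewrite scaler_sumr; apply: eq_bigr => p _.
rewrite scaler_sumr [RHS](reindex_inj (mulIg q)) /=.
apply: eq_big => [s|s _]; first by rewrite col_stabM.
by rewrite scalerA odd_permM signr_addb mulrCA -expr2 sqrr_sign mulr1 !mulgA.
Qed.

Lemma cell_inj (i j : 'I_n) :
  (cell i).1 = (cell j).1 -> (cell i).2 = (cell j).2 -> i = j.
Proof.
move=> ij1 ij2; apply/val_inj/eqP.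
rewrite -(nth_uniq (0%N, 0%N) _ _ (uniq_cells la)) ?size_cellsE ?ltn_ord //.
by rewrite [cell i]surjective_pairing [cell j]surjective_pairing ij1 ij2.
Qed.

(* If [i] lies strictly above [j], let [k] be the cell in the row of [i] and the
   column of [j]: the odd column permutation (j k) is conjugate under (i j) to
   the row permutation (i k), so the symmetrizer twisted by (i j) is its own
   opposite. *)
Lemma twisted_symmetrizer_tperm0 (i j : 'I_n) :
    ((cell i).1 < (cell j).1)%N -> (cell i).2 != (cell j).2 ->
  twisted_symmetrizer (tperm i j) = 0.
Proof.
move=> ltij neij.
have incells (k : 'I_n) : ((cell k).1, (cell k).2) \in cells la.
  by rewrite -surjective_pairing mem_nth // size_cellsE.
have la_sorted : sorted geq la by case/and3P: hla.
have kc := cells_corner la_sorted (incells i) (incells j) ltij.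
have kn : (index ((cell i).1, (cell j).2) (cells la) < n)%N.
  by rewrite -[X in (_ < X)%N]size_cellsE index_mem.
pose k := Ordinal kn.
have kE : cell k = ((cell i).1, (cell j).2) by rewrite nth_index.
have ki : k != i by apply: contraNneq neij => <-; rewrite kE.
have kj : k != j by apply: contraTneq ltij => <-; rewrite kE ltnn.
have ij : i != j by apply: contraTneq ltij => ->; rewrite ltnn.
have colk : tperm j k \in Q by apply: tperm_col_stab; rewrite kE.
have rowk : tperm i k \in P by apply: tperm_row_stab; rewrite kE.
have conj : (tperm j k * tperm i j = tperm i j * tperm i k)%g.
  have := tpermJ j k (tperm i j); rewrite tpermR tpermD 1?eq_sym // => <-.
  by rewrite conjgE tpermV mulgA tperm2 mul1g.
have := twisted_symmetrizer_col (tperm i j) colk.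
rewrite conj twisted_symmetrizer_row // odd_tperm eq_sym kj expr1 scaleN1r.
move/eqP; rewrite -addr_eq0 -mulr2n -scaler_nat scaler_eq0 pnatr_eq0 /=.
by move/eqP.
Qed.

Lemma twisted_symmetrizer_tperm (i j : 'I_n) : i != j ->
  twisted_symmetrizer (tperm i j) =
  (((cell i).1 == (cell j).1)%:R - ((cell i).2 == (cell j).2)%:R) *:
  young_symmetrizer n K la.
Proof.
move=> ij; case: eqP => [ij1|/eqP ij1]; case: eqP => [ij2|/eqP ij2].
- by case/eqP: ij; apply: cell_inj.
- rewrite subr0 scale1r -twisted_symmetrizer1 -[tperm i j]mul1g.
  by rewrite twisted_symmetrizer_row // tperm_row_stab.
- rewrite sub0r -[tperm i j]mulg1 twisted_symmetrizer_col ?tperm_col_stab //.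
  by rewrite odd_tperm ij twisted_symmetrizer1.
(* Neither line is shared; [tperm] being symmetric, the upper of the two cells may be put first. *)
rewrite subrr scale0r; have [lt|lt|/eqP] := ltngtP (cell i).1 (cell j).1.
- exact: twisted_symmetrizer_tperm0.
- by rewrite tpermC; apply: twisted_symmetrizer_tperm0; rewrite // eq_sym.
by rewrite (negbTE ij1).
Qed.

(** For a partition this is the sum over all cells of column index minus row index. *)
Definition content : K := (total_armlength la)%:R - (total_footlength la)%:R.

Let Tsum := \sum_(x : 'I_n * 'I_n | x.1 != x.2) rG (tperm x.1 x.2).

Lemma reindex_pairs (s : 'S_n) (M : nmodType) (F : 'S_n -> M) :
  \sum_(x : 'I_n * 'I_n | x.1 != x.2) F (tperm x.1 x.2) =
  \sum_(x : 'I_n * 'I_n | x.1 != x.2) F (tperm x.1 x.2 ^ s)%g.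
Proof.
rewrite (reindex (fun x : 'I_n * 'I_n => (s x.1, s x.2))) /=.
  apply: eq_big => x; first by rewrite (inj_eq (@perm_inj _ s)).
  by rewrite tpermJ.
exists (fun x => (s^-1%g x.1, s^-1%g x.2)) => x _; rewrite ?permK ?permKV.
  by rewrite -surjective_pairing.
by rewrite -surjective_pairing.
Qed.

Lemma young_symmetrizer_content :
  young_symmetrizer n K la *m Tsum = (content *+ 2) *: young_symmetrizer n K la.
Proof.
transitivity (\sum_(x : 'I_n * 'I_n | x.1 != x.2)
    twisted_symmetrizer (tperm x.1 x.2)).
  rewrite exchange_big mulmx_suml; apply: eq_bigr => p _.
  rewrite exchange_big mulmx_suml; apply: eq_bigr => q _.
  rewrite -scaler_sumr -scalemxAl; congr (_ *: _).
  (* Conjugation by p^-1 permutes the transpositions and turns q t p into q p t. *)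
  rewrite [RHS](reindex_pairs p^-1%g (fun t => group_basis (q * t * p)%g)).
  rewrite mulmx_sumr; apply: eq_bigr => x _.
  by rewrite -/(group_basis _) group_basis_mul conjgE invgK !mulgA mulgKV.
rewrite (eq_bigr _ (fun x xx => twisted_symmetrizer_tperm xx)) -scaler_suml.
have count_pairs (B : rel 'I_n) :
    \sum_(x : 'I_n * 'I_n | x.1 != x.2) (B x.1 x.2)%:R =
    (\sum_(x : 'I_n * 'I_n | (x.1 != x.2) && B x.1 x.2) 1)%:R :> K.
  rewrite natr_sum big_mkcondr; apply: eq_bigr => x _.
  by case: (B _ _).
congr (_ *: _); rewrite sumrB.
rewrite (count_pairs (fun i j => (cell i).1 == (cell j).1)).
rewrite (count_pairs (fun i j => (cell i).2 == (cell j).2)).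
rewrite total_armlength_pairs // total_footlength_pairs //.
by rewrite !natrM /content mulrnBl !mulr_natl.
Qed.

(** [Tsum] is central, so its eigenspace is a submodule; containing the generator, it contains the
    whole Specht module. *)
Lemma specht_content :
  \sum_(x : 'I_n * 'I_n | x.1 != x.2) specht n K la (tperm x.1 x.2) =
  (content *+ 2)%:M.
Proof.
have Tcent s : Tsum *m rG s = rG s *m Tsum.
  rewrite mulmx_suml mulmx_sumr [RHS](reindex_pairs s (fun t => rG s *m rG t)).
  apply: eq_bigr => x _; rewrite -!(repr_mxM rG (in_setT _) (in_setT _)) conjgE.
  by rewrite !mulgA mulgV mul1g.
set c := content *+ 2.
have ker_module : mxmodule rG (kermx (Tsum - c%:M)).
  apply/mxmoduleP => s _; apply/sub_kermxP.
  have -> : kermx (Tsum - c%:M) *m rG s *m (Tsum - c%:M) =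
      kermx (Tsum - c%:M) *m (Tsum - c%:M) *m rG s.
    rewrite -!mulmxA; congr (_ *m _).
    by rewrite mulmxBr mulmxBl Tcent scalar_mxC.
  by rewrite mulmx_ker mul0mx.
have /(cyclic_mx_sub ker_module) specht_ker :
    (young_symmetrizer n K la <= kermx (Tsum - c%:M))%MS.
  apply/sub_kermxP; rewrite mulmxBr young_symmetrizer_content mul_mx_scalar.
  exact: subrr.
set U := cyclic_mx _ _ in specht_ker.
have : val_submod (1%:M : 'M_(\rank U)) *m (Tsum - c%:M) = 0.
  by apply/sub_kermxP; apply: submx_trans specht_ker; rewrite val_submod1.
rewrite mulmxBr mul_mx_scalar => /eqP; rewrite subr_eq0 => /eqP TU.
apply: (@val_submod_inj _ _ U); rewrite raddf_sum /= -scalemx1 linearZ /= -TU.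
rewrite mulmx_sumr; apply: eq_bigr => x _.
by rewrite -(val_submodJ (cyclic_mx_module _ _) _ (in_setT _)) mul1mx.
Qed.

End Content.

(** * The rank formula *)

Theorem proposition5p5 (R : realType) (n : nat) (hn : (2 <= n)%N)
    (f : 'I_n -> sympoly n R[i]) (hf : basic_invariants f)
    (la : seq nat) (hla : is_partition n la) :
  exists2 r : nat, has_rank (homG f (specht n R[i] la)) r &
    r%:R = (dim_specht n R[i] la)%:R *
      (1 / 2 + ((total_armlength la)%:R - (total_footlength la)%:R) /
               (2 * 'C(n, 2)%:R)) :> rat.
Proof.
pose a : 'I_n := Ordinal (ltnW hn); pose b : 'I_n := Ordinal hn.
have ltab : (a < b)%N by [].
exists (\rank (1%:M + specht n R[i] la (tperm a b))%R).
  exact: homG_rank.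
have tr := trace_transposition (isT : a != b) (specht_content R[i] hla).
move: tr (rank_add_tperm (specht n R[i] la) a b).
move: (\tr _) (\rank _) => t r; move: (dim_specht _ _ _) => d; rewrite /content.
move: (total_armlength la) (total_footlength la) => A F.
have -> : (n * n.-1 = 2 * 'C(n, 2))%N.
  by have := bin_ffact n 2; rewrite ffactnS ffactn1 mulnC => <-.
have bin0 : ('C(n, 2)%:R : rat) != 0 by rewrite pnatr_eq0 -lt0n bin_gt0.
rewrite -[t *+ _]mulr_natr -[_ *+ d]mulr_natr -[r%:R *+ _]mulr_natr.
rewrite -[_ *+ 2]mulr_natr natrM => tr rE.
(* The trace identity lives in [R[i]] and the claim in [rat]; freed of subtraction and division, it
   is an identity of natural numbers and passes from one field to the other. *)
have key : (2 * r * 'C(n, 2) + F * d = d * 'C(n, 2) + A * d)%N.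
  have t2 : t = r%:R * 2 - d%:R by rewrite rE; ring.
  have two : (2 : R[i]) != 0 by rewrite pnatr_eq0.
  apply/eqP; rewrite -(eqr_nat R[i]) !natrD !natrM -subr_eq0; apply/eqP.
  apply: (mulfI two); rewrite mulr0; move/eqP: tr; rewrite t2.
  by rewrite -subr_eq0 => /eqP <-; ring.
have {}key : (2 * r%:R * 'C(n, 2)%:R + F%:R * d%:R =
    d%:R * 'C(n, 2)%:R + A%:R * d%:R :> rat).
  by rewrite -!natrM -!natrD key.
(* Multiplication by 2m clears the denominators of the claim. *)
apply: (mulfI (mulf_neq0 (_ : 2 != 0) bin0)) => //.
transitivity (d%:R * 'C(n, 2)%:R + A%:R * d%:R - F%:R * d%:R : rat).
  by rewrite -key; ring.
by field.
Qed.
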